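(* Let $G_0$ be an inverse semigroup of bounded type acting on $\Omega(\mathsf B)$. If $G<\mathsf F(G_0)$ is a finitely generated subgroup of the topological full group of $G_0$ that is orbit equivalent to $G_0$, then $G$ is a group of bounded type.
   Context: **Bratteli diagrams.** A Bratteli diagram $\mathsf B$ consists of finite sets $V_1,V_2,\dots$ (vertices), finite sets $E_1,E_2,\dots$ (edges) and surjective maps $\mathbf s_n:E_n\to V_n$, $\mathbf r_n:E_n\to V_{n+1}$. Paths are written right to left, $e_n\dots e_2e_1$ with $\mathbf r(e_i)=\mathbf s(e_{i+1})$. $\Omega(\mathsf B)\subset\prod_n E_n$ is the space of infinite paths starting in $V_1$, with the subspace topology. **Labeled graphs with boundary.** A graph with boundary has oriented edges with an involution $e\mapsto e^{-1}\ne e$ reversing source and range, where source and range are only partially defined, and each edge has at least one of them. Edges are labeled by a finite set $\mathcal S$ with an involution $F\mapsto F^{-1}$; $e^{-1}$ has the inverse label of $e$. An edge lacking a source or a range is a boundary edge; the vertex it is attached to is a boundary vertex (boundary point). The graph is well-labeled if for each vertex $v$ and $F\in\mathcal S$ at most one edge labeled $F$ starts in $v$ and at most one ends in $v$; it is perfectly labeled if there is exactly one of each. **Tile inflation.** For $v\in V_{n+1}$ the $n$-th level tile $\mathcal T_{v,n}$ is a connected well-labeled graph with boundary whose vertices are the paths of length $n$ ending in $v$. Inductive step: for $v\in V_{n+2}$ take for each $e\in\mathbf r_{n+1}^{-1}(v)$ a copy of $\mathcal T_{\mathbf s(e),n}$, its vertex $\gamma$ being renamed $e\gamma$. Given is a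 set $P_{n+1}$ of connectors $(e_1\gamma_1,e_2\gamma_2,F)$, where $\gamma_1,\gamma_2$ are boundary points of $n$-th level tiles having boundary edges with the same label $F$, one lacking its source and the other its range. For each connector join $e_1\gamma_1$ and $e_2\gamma_2$ (called connecting points) by a pair of mutually inverse edges labeled $F$, $F^{-1}$ (replacing these boundary edges). The result is $\mathcal T_{v,n+1}$; remaining boundary edges stay boundary edges. For $\gamma=\dots e_2e_1\in\Omega(\mathsf B)$ the infinite tile $\mathcal T_\gamma$ is the inductive limit of the tiles along the embeddings $\eta\mapsto e_i\eta$. A vertex of an infinite tile is a boundary point of it if all its truncations $e_n\dots e_1$ are boundary points of finite tiles. **The inverse semigroup.** Each label $F\in\mathcal S$ defines a partial homeomorphism of $\Omega(\mathsf B)$: $\gamma\cdot F$ is the end of the edge of $\mathcal T_\gamma$ labeled $F$ starting at $\gamma$; it is assumed extended continuously to the boundary points of infinite tiles, so that $F$ has clopen domain. $G_0=\langle\mathcal S\rangle$ is the generated inverse semigroup of partial homeomorphisms (right action). The orbital graph of $\gamma$ has vertex set $\gamma\cdot G_0$ and an edge labeled $F$ from $\eta$ to $\eta\cdot F$ whenever defined. **Bounded type.** The tile inflation process (and $G_0$) is of bounded type if (1) the numbers of boundary points of finite tiles are uniformly bounded and there are only finitely many boundary points of infinite tiles; (2) $|V_n|$ and $|E_n|$ are uniformly bounded. If $S$ is the finite labeling set of a tile inflation process of bounded type, then $G=\langle S\rangle$ is a group of bounded type if, after extending the action of some labels at boundary points of infinite tiles, the process determines perfectly labeled orbital graphs labeled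 by elements of $S$. **Full group, orbit equivalence.** The topological full group $\mathsf F(G_0)$ is the group of homeomorphisms $f$ of $\Omega(\mathsf B)$ such that for each $\gamma$ there is $g\in G_0$ defined on a neighborhood of $\gamma$ with $f=g$ on a neighborhood of $\gamma$. Actions of $G_1,G_2$ on $\Omega(\mathsf B)$ are orbit equivalent if there are homeomorphisms $\varphi,\psi$ of $\Omega(\mathsf B)$ such that for every $\gamma$ and $g_1\in G_1$ defined at $\gamma$ there is $g_2\in G_2$ defined at $\varphi(\gamma)$ with $\varphi(\gamma\cdot g_1)=\varphi(\gamma)\cdot g_2$, and for every $\gamma$ and $g_2'\in G_2$ defined at $\gamma$ there is $g_1'\in G_1$ defined at $\psi(\gamma)$ with $\psi(\gamma\cdot g_2')=\psi(\gamma)\cdot g_1'$. *)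

(* Defs.v *)
From HB Require Import structures.
From mathcomp Require Import all_boot all_classical topology.

Set Implicit Arguments.
Unset Strict Implicit.
Unset Printing Implicit Defensive.

Local Open Scope classical_set_scope.

(** * Bratteli diagrams and their path spaces *)

(* Indices start at 0: [vert B n] is V_{n+1} and [edge B n] is E_{n+1}. *)
Record bratteli := Bratteli {
  vert : nat -> finType;
  edge : nat -> finType;
  src : forall n, edge n -> vert n;
  rng : forall n, edge n -> vert n.+1;
  src_surj : forall n (v : vert n), exists e, src e = v;
  rng_surj : forall n (v : vert n.+1), exists e, rng e = v }.

(* The finite type of paths e_{n+1} ... e_2 e_1 of length n+1 starting in V_1,
   together with the map giving their last vertex. *)
Fixpoint bpath_rec (B : bratteli) (n : nat) : {T : finType & T -> vert B n.+1} :=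
  match n return {T : finType & T -> vert B n.+1} with
  | 0 => existT (fun T : finType => T -> vert B 1) (edge B 0) (@rng B 0)
  | m.+1 =>
    let P := bpath_rec B m in
    existT (fun T : finType => T -> vert B m.+2)
      ({x : edge B m.+1 * projT1 P | src x.1 == projT2 P x.2} : finType)
      (fun x => rng (val x).1)
  end.

Definition bpath (B : bratteli) (n : nat) : finType := projT1 (bpath_rec B n).

Definition pend (B : bratteli) (n : nat) (p : bpath B n) : vert B n.+1 :=
  projT2 (bpath_rec B n) p.

(* A path of length n+2 is written [phead p . ptail p]: the last edge is on the
   left. *)
Definition phead (B : bratteli) (n : nat) (p : bpath B n.+1) : edge B n.+1 :=
  (val p).1.

Definition ptail (B : bratteli) (n : nat) (p : bpath B n.+1) : bpath B n :=
  (val p).2.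

Definition is_ipath (B : bratteli) :
    set (prod_topology (fun n => discrete_topology (edge B n))) :=
  [set x | forall n, rng (x n : edge B n) = src (x n.+1 : edge B n.+1)].

Definition Omega (B : bratteli) : topologicalType := set_type (@is_ipath B).

Definition iedge (B : bratteli) (x : Omega B) (n : nat) : edge B n :=
  set_val x n.

Lemma iedge_comp (B : bratteli) (x : Omega B) n :
  rng (iedge x n) = src (iedge x n.+1).
Proof. exact: (set_valP x). Qed.

Lemma trunc_subproof (B : bratteli) (x : Omega B) n (p : bpath B n) :
  pend p = rng (iedge x n) -> src (iedge x n.+1, p).1 == pend p.
Proof. by move=> ->; rewrite iedge_comp. Qed.

Fixpoint trunc_rec (B : bratteli) (x : Omega B) (n : nat) :
    {p : bpath B n | pend p = rng (iedge x n)} :=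
  match n return {p : bpath B n | pend p = rng (iedge x n)} with
  | 0 => exist (fun p : bpath B 0 => pend p = rng (iedge x 0))
           (iedge x 0) erefl
  | m.+1 =>
    let t := trunc_rec x m in
    exist (fun p : bpath B m.+1 => pend p = rng (iedge x m.+1))
      (exist _ (iedge x m.+1, proj1_sig t) (trunc_subproof (proj2_sig t)))
      erefl
  end.

Definition trunc (B : bratteli) (x : Omega B) (n : nat) : bpath B n :=
  proj1_sig (trunc_rec x n).

(** * Labeled graphs with boundary *)

(* In a well-labeled graph an edge is determined by its label together with its
   source or its range. So an edge is encoded as a triple
   (source, label, range), where [None] stands for a missing endpoint, and a
   graph with vertex set V as a set of triples. The inverse of the edge
   (a, F, b) is (b, F^-1, a). *)
Definition gedge (L V : finType) : finType := (option V * L * option V)%type.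

Record well_labeled (L V : finType) (linv : L -> L) (g : {set gedge L V}) :
    Prop := WellLabeled {
  wl_end : forall F, (None, F, None) \notin g;
  wl_inv : forall a F b, (a, F, b) \in g -> (b, linv F, a) \in g;
  wl_inv_neq : forall a F b, (a, F, b) \in g -> (b, linv F, a) <> (a, F, b);
  wl_out : forall v F b b',
    (Some v, F, b) \in g -> (Some v, F, b') \in g -> b = b';
  wl_in : forall v F a a',
    (a, F, Some v) \in g -> (a', F, Some v) \in g -> a = a' }.

Definition is_boundary (L V : finType) (g : {set gedge L V}) (v : V) : bool :=
  [exists F, ((Some v, F, None) \in g) || ((None, F, Some v) \in g)].

Definition adjacent (L V : finType) (g : {set gedge L V}) : rel V :=
  fun v w => [exists F, (Some v, F, Some w) \in g].

(** * Tile inflations *)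

Definition connector (B : bratteli) (L : finType) (n : nat) : finType :=
  (bpath B n.+1 * bpath B n.+1 * L)%type.

(* The connector (p, q, F) creates the edge labeled F from p to q and its
   inverse, labeled F^-1, from q to p. *)
Definition connects (B : bratteli) (L : finType) (linv : L -> L) (n : nat)
    (P : {set connector B L n}) (p : bpath B n.+1) (F : L) (q : bpath B n.+1) :
    bool :=
  ((p, q, F) \in P) || ((q, p, linv F) \in P).

Definition inflate (B : bratteli) (L : finType) (linv : L -> L) (n : nat)
    (g : {set gedge L (bpath B n)}) (P : {set connector B L n}) :
    {set gedge L (bpath B n.+1)} :=
  [set x : gedge L (bpath B n.+1) |
    match x with
    | (Some p, F, Some q) =>
        (phead p == phead q) && ((Some (ptail p), F, Some (ptail q)) \in g)
        || connects linv P p F q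
    | (Some p, F, None) =>
        ((Some (ptail p), F, None) \in g) && ~~ [exists q, connects linv P p F q]
    | (None, F, Some q) =>
        ((None, F, Some (ptail q)) \in g) && ~~ [exists p, connects linv P p F q]
    | (None, _, None) => false
    end].

(* [tiles linv g0 P n] is the disjoint union, over v, of the tiles of level n+1;
   the tile of v is its part spanned by the paths ending in v. *)
Fixpoint tiles (B : bratteli) (L : finType) (linv : L -> L)
    (g0 : {set gedge L (bpath B 0)}) (P : forall n, {set connector B L n})
    (n : nat) : {set gedge L (bpath B n)} :=
  match n return {set gedge L (bpath B n)} with
  | 0 => g0
  | m.+1 => inflate linv (tiles linv g0 P m) (P m)
  end.

(* [ti_base] is given by the first level tiles; [ti_conn n] is P_{n+2}, the set
   of connectors producing the tiles of level n+2. *)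
Record tile_inflation (B : bratteli) := TileInflation {
  ti_label : finType;
  ti_inv : ti_label -> ti_label;
  ti_invK : involutive ti_inv;
  ti_base : {set gedge ti_label (bpath B 0)};
  ti_conn : forall n, {set connector B ti_label n};
  ti_base_tile : forall p F q,
    (Some p, F, Some q) \in ti_base -> pend p = pend q;
  ti_conn_tile : forall n p q F, (p, q, F) \in ti_conn n ->
    [/\ pend p = pend q,
        (Some (ptail p), F, None) \in tiles ti_inv ti_base ti_conn n &
        (None, F, Some (ptail q)) \in tiles ti_inv ti_base ti_conn n];
  ti_well_labeled : forall n,
    well_labeled ti_inv (tiles ti_inv ti_base ti_conn n);
  ti_connected : forall n (p q : bpath B n), pend p = pend q ->
    connect (adjacent (tiles ti_inv ti_base ti_conn n)) p q }.

Definition tile (B : bratteli) (T : tile_inflation B) (n : nat) :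
    {set gedge (ti_label T) (bpath B n)} :=
  tiles (@ti_inv B T) (ti_base T) (@ti_conn B T) n.

(* The vertices of the infinite tile of x are the paths that coincide with x
   from some level on. *)
Definition itile_edge (B : bratteli) (T : tile_inflation B) (x y : Omega B)
    (F : ti_label T) (z : Omega B) : Prop :=
  exists n, [/\ forall i, n < i -> iedge y i = iedge x i,
                forall i, n < i -> iedge z i = iedge x i &
                (Some (trunc y n), F, Some (trunc z n)) \in tile T n].

Definition iboundary (B : bratteli) (T : tile_inflation B) : set (Omega B) :=
  [set x | forall n, is_boundary (tile T n) (trunc x n)].

Definition bounded_type (B : bratteli) (T : tile_inflation B) : Prop :=
  [/\ exists N : nat, forall n (v : vert B n.+1),
        (#|[set p : bpath B n | (pend p == v) && is_boundary (tile T n) p]%SET|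
           <= N)%N,
      finite_set (iboundary T) &
      exists N : nat, forall n, (#|vert B n| <= N)%N /\ (#|edge B n| <= N)%N].

(** * Partial homeomorphisms and generated inverse semigroups *)

Definition pmap (X : Type) := X -> option X.

Definition pdom (X : Type) (f : pmap X) : set X := [set x | isSome (f x)].

Definition pcontinuous (X : topologicalType) (f : pmap X) : Prop :=
  {within pdom f, continuous (fun x => odflt x (f x))}.

Definition partial_homeo (X : topologicalType) (f g : pmap X) : Prop :=
  [/\ open (pdom f) /\ open (pdom g),
      pcontinuous f /\ pcontinuous g &
      forall x y, f x = Some y <-> g y = Some x].

(* Maps act on the right: [pcomp f g] is first f, then g. *)
Definition pcomp (X : Type) (f g : pmap X) : pmap X := fun x => obind g (f x).

(* The action of the labels, continuously extended to (some) boundary points of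
   infinite tiles so as to have clopen domains. *)
Record label_action (B : bratteli) (T : tile_inflation B) := LabelAction {
  act : ti_label T -> pmap (Omega B);
  act_tile : forall F x y, itile_edge x x F y -> act F x = Some y;
  act_boundary : forall F x y,
    act F x = Some y -> itile_edge x x F y \/ iboundary T x;
  act_homeo : forall F, partial_homeo (act F) (act (ti_inv F));
  act_clopen : forall F, clopen (pdom (act F)) }.

(* The inverse semigroup (with identity) generated by a set of partial maps that
   is closed under taking inverses. *)
Inductive generated_pmap (X : Type) (A : set (pmap X)) : pmap X -> Prop :=
| gen_id : generated_pmap A (fun x => Some x)
| gen_in f : A f -> generated_pmap A f
| gen_comp f g : generated_pmap A f -> generated_pmap A g ->
    generated_pmap A (pcomp f g).

Definition label_semigroup (B : bratteli) (T : tile_inflation B)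
    (a : label_action T) : set (pmap (Omega B)) :=
  generated_pmap (range (act a)).

Definition orbit_of (X : Type) (G0 : set (pmap X)) (x : X) : set X :=
  [set y | exists2 g, G0 g & g x = Some y].

Definition orbital_edge (B : bratteli) (T : tile_inflation B)
    (a : label_action T) (x y : Omega B) (F : ti_label T) (z : Omega B) : Prop :=
  [/\ orbit_of (label_semigroup a) x y, orbit_of (label_semigroup a) x z &
      act a F y = Some z].

Definition perfectly_labeled (B : bratteli) (T : tile_inflation B)
    (a : label_action T) : Prop :=
  forall x y F, orbit_of (label_semigroup a) x y ->
    (exists! z, orbital_edge a x y F z) /\ (exists! z, orbital_edge a x z F y).

(** * Groups of homeomorphisms *)

Definition homeo_pair (X Y : topologicalType) (f : X -> Y) (g : Y -> X) : Prop :=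
  [/\ continuous f, continuous g, cancel f g & cancel g f].

Definition homeo (X : topologicalType) (f : X -> X) : Prop :=
  exists g, homeo_pair f g.

Definition homeo_group (X : topologicalType) (G : set (X -> X)) : Prop :=
  [/\ G `<=` @homeo X, G id,
      forall f g, G f -> G g -> G (g \o f) &
      forall f g, G f -> homeo_pair f g -> G g].

Definition finitely_generated (X : topologicalType) (G : set (X -> X)) : Prop :=
  exists A : set (X -> X), [/\ finite_set A, A `<=` G &
    forall H, homeo_group H -> A `<=` H -> G `<=` H].

Definition full_group (X : topologicalType) (G0 : set (pmap X)) : set (X -> X) :=
  [set f | homeo f /\
     forall x : X, exists2 g, G0 g & \forall y \near x, g y = Some (f y)].

Definition pmaps_of (X : Type) (G : set (X -> X)) : set (pmap X) :=
  [set (fun x => Some (f x)) | f in G].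

Definition orbit_map (X : topologicalType) (G1 G2 : set (pmap X)) (f : X -> X) :
    Prop :=
  forall x y g1, G1 g1 -> g1 x = Some y ->
    exists2 g2, G2 g2 & g2 (f x) = Some (f y).

Definition orbit_equivalent (X : topologicalType) (G1 G2 : set (pmap X)) : Prop :=
  exists phi psi : X -> X,
    [/\ homeo phi, homeo psi, orbit_map G1 G2 phi & orbit_map G2 G1 psi].

(* Up to a homeomorphism h between the two spaces, G is the group generated by
   the labels of a tile inflation of bounded type. *)
Definition bounded_type_group (X : topologicalType) (G : set (X -> X)) : Prop :=
  exists (B : bratteli) (T : tile_inflation B) (a : label_action T)
         (h : Omega B -> X) (k : X -> Omega B),
    [/\ bounded_type T, perfectly_labeled a, homeo_pair h k &
        forall f : X -> X,
          G f <-> label_semigroup a (fun x => Some (k (f (h x))))].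

(* Main.v *)
(** Let S be a finite generating set of G, closed under inverses. Join two finite
paths p, q of the same length by an edge labeled F in S when F replaces the
initial segment p by q on the whole cylinder of p. These graphs form a tile
inflation in all respects but connectedness, which is restored by taking for
the vertices of a new Bratteli diagram their connected components; its path
space is canonically homeomorphic to that of B.

Bounded type is then a matter of counting. Call p unsettled for a partial map f
when f is defined somewhere on the cylinder of p without acting on the whole of
it by a change of initial segment. For a label of the original inflation only
boundary points are unsettled; the number of unsettled paths is subadditive
under composition, and by compactness an element of the full group is given by
finitely many elements of G_0. So the number of unsettled paths of each level is
bounded, and hence so is the number of components containing one. A component
without unsettled paths, extended by any tail, is a finite union of G-orbits;
orbit equivalence maps it back into a finite set containing full tail classes,
and the path space has at most max |V_n| finite tail classes. *)

Require Import Defs.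
From mathcomp Require Import all_boot all_classical topology finmap.

Local Open Scope classical_set_scope.

Set Implicit Arguments.
Unset Strict Implicit.
Unset Printing Implicit Defensive.

(** * Finite families and uniform levels *)

Lemma infinite_family (T : choiceType) (A : set T) n : infinite_set A ->
  exists2 y : 'I_n -> T, injective y & forall i, A (y i).
Proof.
move=> iA; have [x0 _] := infinite_setN0 iA.
have [X XA nX] := infinite_set_fset n iA.
exists (fun i => nth x0 (enum_fset X) i) => [i j|i].
  move/eqP; rewrite nth_uniq ?fset_uniq ?(leq_trans (ltn_ord _) nX) //.
  by move=> /eqP; exact: val_inj.
by apply: XA; apply: mem_nth; exact: leq_trans (ltn_ord i) nX.
Qed.

Lemma uniform_level (I : finType) (P : I -> nat -> Prop) :
  (forall i n m, n <= m -> P i n -> P i m) -> (forall i, exists n, P i n) ->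
  exists n, forall i, P i n.
Proof.
move=> Pm /choice[f fP]; exists (\max_i f i) => i.
by apply: Pm (fP i); exact: leq_bigmax.
Qed.

(** * Paths and cylinders *)

Definition same_tail (B : bratteli) (n : nat) (x y : Omega B) : Prop :=
  forall i, n < i -> iedge x i = iedge y i.

Section Paths.
Variable B : bratteli.
Implicit Types (n m : nat) (x y z : Omega B).

Lemma iedge_inj x y : (forall i, iedge x i = iedge y i) -> x = y.
Proof.
move=> e; apply: val_inj; have : set_val x = set_val y.
  by apply: functional_extensionality_dep => i; exact: e.
by rewrite !set_valE.
Qed.

Definition ipath_of (u : forall i, edge B i)
  (uP : forall i, rng (u i) = src (u i.+1)) : Omega B := SigSub (mem_set uP : u \in @is_ipath B).

Lemma iedge_ipath_of (u : forall i, edge B i) uP i : iedge (@ipath_of u uP) i = u i.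
Proof. by []. Qed.

Lemma pend_trunc x n : pend (trunc x n) = rng (iedge x n).
Proof. exact: (proj2_sig (trunc_rec x n)). Qed.

Lemma phead_trunc x n : phead (trunc x n.+1) = iedge x n.+1.
Proof. by []. Qed.

Lemma ptail_trunc x n : ptail (trunc x n.+1) = trunc x n.
Proof. by []. Qed.

Lemma bpath_eq n (p q : bpath B n.+1) :
  phead p = phead q -> ptail p = ptail q -> p = q.
Proof.
by move=> eh et; apply: val_inj; apply/eqP; apply/andP; split; apply/eqP.
Qed.

Lemma src_phead n (p : bpath B n.+1) : src (phead p) = pend (ptail p).
Proof. exact: (eqP (valP p)). Qed.

Lemma pend_phead n (p : bpath B n.+1) : pend p = rng (phead p).
Proof. by []. Qed.

Definition bcons n (e : edge B n.+1) (p : bpath B n) (h : src e == pend p) :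
  bpath B n.+1 := exist (fun u : edge B n.+1 * bpath B n => src u.1 == pend u.2) (e, p) h.

Lemma trunc_eqP x y n :
  trunc x n = trunc y n <-> forall i, i <= n -> iedge x i = iedge y i.
Proof.
elim: n => [|n IH]; split.
- by move=> e i; rewrite leqn0 => /eqP ->.
- by move=> e; exact: (e 0).
- move=> e i; rewrite leq_eqVlt ltnS => /predU1P[->|]; first exact: (congr1 (@phead _ _) e).
  by apply: IH.1; exact: (congr1 (@ptail _ _) e).
- move=> e; apply: bpath_eq; first exact: e.
  by apply/IH => i /leqW; exact: e.
Qed.

Lemma trunc_le x y n m : n <= m -> trunc x m = trunc y m -> trunc x n = trunc y n.
Proof.
by move=> nm /trunc_eqP e; apply/trunc_eqP => i le; apply/e/(leq_trans le).
Qed.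

Lemma same_tail_refl n x : same_tail n x x. Proof. by []. Qed.

Lemma same_tail_sym n x y : same_tail n x y -> same_tail n y x.
Proof. by move=> e i /e. Qed.

Lemma same_tail_trans n x y z : same_tail n x y -> same_tail n y z -> same_tail n x z.
Proof. by move=> e e' i ni; rewrite (e i ni) (e' i ni). Qed.

Lemma same_tail_le n m x y : n <= m -> same_tail n x y -> same_tail m x y.
Proof. by move=> nm e i mi; apply/e/(leq_ltn_trans nm). Qed.

Lemma eq_trunc_tail n x y : trunc x n = trunc y n -> same_tail n x y -> x = y.
Proof.
by move=> /trunc_eqP e e'; apply: iedge_inj => i; case: (leqP i n); [exact: e|exact: e'].
Qed.

Lemma pend_same_tail n x y : same_tail n x y -> pend (trunc x n) = pend (trunc y n).
Proof. by move=> e; rewrite !pend_trunc !iedge_comp e. Qed.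

(** Only the part of [u] above level [n] has to be a path, so the induction can write the edges of
    [p] into [u] one at a time, from the last edge down. *)
Lemma splice_seq n (p : bpath B n) (u : forall i, edge B i) :
  pend p = src (u n.+1) -> (forall i, n < i -> rng (u i) = src (u i.+1)) ->
  exists x, trunc x n = p /\ forall i, n < i -> iedge x i = u i.
Proof.
elim: n p u => [|n IH] p u pu uP.
  have uP' i : rng (eqtype.dfwith u (p : edge B 0) i) = src (eqtype.dfwith u (p : edge B 0) i.+1).
    rewrite (@eqtype.dfwith_out _ _ _ 0 _ i.+1) //; case: i => [|i]; first by rewrite dfwith_in.
    by rewrite dfwith_out // uP.
  exists (ipath_of uP'); split; first exact: dfwith_in.
  by move=> i i0; rewrite iedge_ipath_of dfwith_out // eq_sym -lt0n.
have [||x [xp xu]] := IH (ptail p) (eqtype.dfwith u (phead p)).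
- by rewrite dfwith_in src_phead.
- move=> i ni; rewrite [in RHS]dfwith_out; last by rewrite eqSS; apply: contraTneq ni => ->; rewrite ltnn.
  case: (eqVneq i n.+1) ni => [->|iN] ni; first by rewrite dfwith_in.
  by rewrite dfwith_out 1?eq_sym // uP // ltn_neqAle eq_sym iN.
exists x; split; last first.
  by move=> i ni; rewrite xu 1?ltnW // dfwith_out // neq_ltn ni.
by apply: bpath_eq; rewrite ?phead_trunc ?ptail_trunc // xu // dfwith_in.
Qed.

Lemma splice n (p : bpath B n) x :
  pend p = pend (trunc x n) -> exists y, trunc y n = p /\ same_tail n y x.
Proof.
move=> pe; apply: splice_seq => [|i _]; first by rewrite pe pend_trunc iedge_comp.
exact: iedge_comp.
Qed.

Lemma bpath_first n : bpath B n -> edge B 0.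
Proof. by elim: n => [//|n IH] p; exact: IH (ptail p). Qed.

(** Surjectivity of the sources continues every edge upwards. Below level [n] the values of [u] are
    arbitrary; [e0] is there to produce them. *)
Lemma ray_from n (e : edge B n) (e0 : edge B 0) :
  exists u : forall i, edge B i, u n = e /\ forall i, n <= i -> rng (u i) = src (u i.+1).
Proof.
have nextP i (f : edge B i) : {f' : edge B i.+1 | src f' = rng f}.
  by apply: cid; exact: src_surj.
pose next i f := sval (nextP i f).
have nextE i f : src (next i f) = rng f by exact: (svalP (nextP i f)).
pose d := eqtype.dfwith (fix r i : edge B i := if i is j.+1 then next j (r j) else e0) e.
pose u := fix r i : edge B i :=
  match i with
  | 0 => d 0
  | j.+1 => if j.+1 <= n then d j.+1 else next j (r j)
  end.
have ud i : i <= n -> u i = d i by case: i => [//|i] /= ->.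
exists u; split; first by rewrite ud // /d dfwith_in.
by move=> i ni; rewrite [in RHS]/u ltnNge ni /= nextE.
Qed.

Lemma trunc_surj n (p : bpath B n) : exists x, trunc x n = p.
Proof.
have [e pe] : exists e : edge B n, pend p = rng e.
  by case: n p => [|n] p; [exists p|exists (phead p)].
have [u [un uP]] := ray_from e (bpath_first p).
have [||x [xp _]] := @splice_seq n p u; last by exists x.
  by rewrite -uP // un.
by move=> i /ltnW; exact: uP.
Qed.

Lemma ipath_lim (p : forall n, bpath B n) :
  (forall n, ptail (p n.+1) = p n) -> exists x, forall n, trunc x n = p n.
Proof.
move=> pP; have /choice[y yP] n : exists y, trunc y n = p n by exact: trunc_surj.
have yE m n : n <= m -> trunc (y m) n = p n.
  elim: m => [|m IH]; first by rewrite leqn0 => /eqP ->; exact: yP.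
  rewrite leq_eqVlt ltnS => /predU1P[->|nm]; first exact: yP.
  rewrite -(IH nm); apply: (@trunc_le _ _ n m) => //.
  by rewrite -ptail_trunc yP pP yP.
have uP i : rng (iedge (y i) i) = src (iedge (y i.+1) i.+1).
  rewrite -(iedge_comp (y i.+1) i) -!pend_trunc; congr pend.
  by rewrite yP yE.
exists (ipath_of uP) => n; rewrite -(yP n); apply/trunc_eqP => i ni.
rewrite iedge_ipath_of.
have /trunc_eqP -> // : trunc (y i) i = trunc (y n) i by rewrite yP yE.
Qed.

(** The topology is induced from a product of discrete spaces: convergence is coordinatewise, and
    eventual constancy suffices in each coordinate. *)
Lemma cvg_ipath (F : set_system (Omega B)) x : Filter F ->
  (forall n, F [set y | iedge y n = iedge x n]) -> F --> x.
Proof.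
move=> FF Fx A; rewrite nbhsE => -[_ [[W oW <-] /= Wx] sA].
apply: (filterS sA).
have FFv : Filter (set_val @ F) by exact: fmap_filter.
suff /(_ W) : (set_val @ F) --> (set_val x : prod_topology (fun n => discrete_topology (edge B n))).
  by apply; apply: open_nbhs_nbhs.
apply/cvg_sup => i V; rewrite nbhsE => -[_ [[U oU <-] /= Ux] sV].
apply: (filterS sV); apply: (@filterS _ F _ [set y | iedge y i = iedge x i] _ _ (Fx i)) => y /= e.
by rewrite /iedge in e; rewrite e.
Qed.

Lemma near_iedge n x : \forall y \near x, iedge y n = iedge x n.
Proof.
have c1 := @initial_continuous (Omega B) _ (set_val : Omega B -> _).
have c2 := @proj_continuous nat (fun m => discrete_topology (edge B m) : topologicalType) n.
have := continuous_comp (c1 x) (c2 _).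
move=> /(_ [set (iedge x n : discrete_topology (edge B n))]).
apply; exact: discrete_set1.
Qed.

Lemma near_trunc n x : \forall y \near x, trunc y n = trunc x n.
Proof.
suff : \forall y \near x, forall i, i <= n -> iedge y i = iedge x i.
  by apply: filterS => y /trunc_eqP.
elim: n => [|n IH].
  by have := near_iedge 0 x; apply: filterS => y e i; rewrite leqn0 => /eqP ->.
have := near_iedge n.+1 x; move: IH; apply: filterS2 => y IH e i.
by rewrite leq_eqVlt ltnS => /predU1P[->|/IH].
Qed.

(** The cylinders around [x] generate a filter that converges to [x], hence form a base of
    neighbourhoods. *)
Lemma nbhs_trunc x (A : set (Omega B)) :
  (\forall y \near x, A y) -> exists n, forall y, trunc y n = trunc x n -> A y.
Proof.
move=> nA.
pose F := filter_from [set: nat] (fun n => [set y | trunc y n = trunc x n]).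
have FF : Filter F.
  apply: filter_from_filter; first by exists 0.
  move=> i j _ _; exists (maxn i j) => // y /= e.
  by split; apply: trunc_le e; rewrite ?leq_maxl ?leq_maxr.
suff /(_ _ nA) [n _ nP] : F --> x by exists n.
by apply: cvg_ipath => n; exists n => // y /= /trunc_eqP; apply.
Qed.

Lemma trunc_separate (I : finType) (y : I -> Omega B) :
  injective y -> exists n, injective (fun i => trunc (y i) n).
Proof.
move=> yI; pose P (u : I * I) n := trunc (y u.1) n = trunc (y u.2) n -> u.1 = u.2.
have [|u|n nP] := @uniform_level _ P.
- by move=> u n m nm h e; apply: h; exact: trunc_le e.
- have [/yI e|] := pselect (y u.1 = y u.2); first by exists 0.
  have [h _|h] := pselect (exists n, trunc (y u.1) n <> trunc (y u.2) n).
    by have [n nP] := h; exists n.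
  case; apply: iedge_inj => k.
  have /trunc_eqP -> // : trunc (y u.1) k = trunc (y u.2) k.
  by apply: contrapT => e; apply: h; exists k.
- by exists n => i j; exact: (nP (i, j)).
Qed.

(** Any [N.+1] distinct points of [S] would have distinct truncations at some level. This turns a
    uniform bound on finite tiles into finiteness of the boundary of the infinite tiles. *)
Lemma finite_of_trunc (S : set (Omega B)) N (P : forall n, {set bpath B n}) :
  (forall x n, S x -> trunc x n \in P n) -> (forall n, #|P n| <= N) -> finite_set S.
Proof.
move=> SP PN; apply: contrapT => /(infinite_family N.+1)[y yI yS].
have [n nI] := trunc_separate yI.
have : #|[set trunc (y i) n | i : 'I_N.+1]%SET| <= N.
  apply: leq_trans (PN n); apply: subset_leq_card.
  by apply/fintype.subsetP => _ /imsetP[i _ ->]; exact: SP.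
by rewrite card_imset // card_ord ltnn.
Qed.

End Paths.

Lemma continuous_ipath (X : topologicalType) (B : bratteli) (f : X -> Omega B) :
  (forall x n, \forall y \near x, iedge (f y) n = iedge (f x) n) -> continuous f.
Proof. by move=> fP x; apply: cvg_ipath => n; exact: fP. Qed.

(** * The tiles of a finite set of homeomorphisms *)

Section Moves.
Variables (B : bratteli) (L : finType) (s : L -> Omega B -> Omega B).

(* The edges of the tiles are defined by the action itself: [p] is joined to [q]
   when the generator replaces the initial segment [p] by [q] on the whole
   cylinder of [p]. *)
Definition moves n (p : bpath B n) (F : L) (q : bpath B n) : bool :=
  `[< forall x, trunc x n = p -> trunc (s F x) n = q /\ same_tail n (s F x) x >].

(** Outgoing edges suffice: a missing incoming edge labeled [F] is a missing outgoing edge labeled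
    [linv F]. *)
Definition unsettled n (p : bpath B n) : bool :=
  [exists F, ~~ [exists q, moves p F q]].

Definition moves_adj n : rel (bpath B n) := fun p q => [exists F, moves p F q].

Lemma movesP n (p : bpath B n) F q :
  reflect (forall x, trunc x n = p -> trunc (s F x) n = q /\ same_tail n (s F x) x)
    (moves p F q).
Proof. exact: asboolP. Qed.

Lemma moves_fun n (p : bpath B n) F q q' : moves p F q -> moves p F q' -> q = q'.
Proof.
by have [x <-] := trunc_surj p => /movesP/(_ x erefl)[<- _] /movesP/(_ x erefl)[<- _].
Qed.

Lemma moves_pend n (p : bpath B n) F q : moves p F q -> pend p = pend q.
Proof.
have [x <-] := trunc_surj p => /movesP/(_ x erefl)[<- t].
by rewrite (pend_same_tail t).
Qed.

Lemma moves_cons n (p q : bpath B n.+1) F :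
  phead p = phead q -> moves (ptail p) F (ptail q) -> moves p F q.
Proof.
move=> e /movesP m; apply/movesP => x xp.
have [|t1 t2] := m x; first by rewrite -xp.
split; last exact: same_tail_le t2.
by apply: bpath_eq; rewrite ?ptail_trunc // phead_trunc t2 // -e -xp.
Qed.

Lemma moves_cons_ex n (p : bpath B n.+1) F (r : bpath B n) :
  moves (ptail p) F r -> exists q, [/\ phead q = phead p, ptail q = r & moves p F q].
Proof.
move=> m; have e : src (phead p) == pend r by rewrite src_phead (moves_pend m).
by exists (bcons e); split=> //; exact: moves_cons.
Qed.

Variable linv : L -> L.
Hypotheses (linvK : involutive linv) (sK : forall F, cancel (s F) (s (linv F))).

(** The cylinder of [p] is mapped onto that of [q]: a point [y] over [q] is the image of the point
    with initial segment [p] and the tail of [y]. *)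
Lemma moves_inv n (p : bpath B n) F q : moves p F q -> moves q (linv F) p.
Proof.
move=> m; apply/movesP => y yq; have [|x [xp xy]] := @splice _ _ p y.
  by rewrite yq (moves_pend m).
have [xq t] := movesP _ _ _ m x xp.
have <- : s F x = y by apply: (@eq_trunc_tail _ n); rewrite ?xq ?yq //; exact: same_tail_trans xy.
by rewrite sK; split=> //; exact: same_tail_sym.
Qed.

Lemma moves_invE n (p : bpath B n) F q : moves q (linv F) p = moves p F q.
Proof. by apply/idP/idP => /moves_inv //; rewrite linvK. Qed.

Lemma moves_adj_sym n : symmetric (@moves_adj n).
Proof.
by move=> p q; apply/existsP/existsP => -[F m]; exists (linv F); exact: moves_inv.
Qed.

Lemma moves_adj_connect_sym n : connect_sym (@moves_adj n).
Proof. exact/sym_connect_sym/moves_adj_sym. Qed.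

(** Each edge survives when the same edge of [B] is appended to both of its ends, so a chain lifts
    step by step. This makes the components of successive levels compatible. *)
Lemma moves_adj_cons n (p q : bpath B n.+1) :
  phead p = phead q -> connect (@moves_adj n) (ptail p) (ptail q) ->
  connect (@moves_adj n.+1) p q.
Proof.
move=> e /connectP[w]; elim: w p e => [|r w IH] p e /=.
  by move=> _ tE; rewrite (bpath_eq e (esym tE)).
case/andP => /existsP[F m] wP lE; have [p' [hp' tp' m']] := moves_cons_ex m.
apply: (@connect_trans _ _ p').
  by apply: connect1; apply/existsP; exists F.
by apply: IH; rewrite ?hp' // tp'.
Qed.

Definition moves_tile n : {set gedge L (bpath B n)} :=
  [set u : gedge L (bpath B n) |
    match u with
    | (Some p, F, Some q) => moves p F q
    | (Some p, F, None) => ~~ [exists q, moves p F q]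
    | (None, F, Some q) => ~~ [exists p, moves p F q]
    | (None, _, None) => false
    end].

(** Only new edges are connectors: when the tail of the first path already has an edge labeled [F],
    the edge at hand is a copy of that one. *)
Definition moves_conn n : {set connector B L n} :=
  [set c : connector B L n |
    moves c.1.1 c.2 c.1.2 && ~~ [exists r, moves (ptail c.1.1) c.2 r]].

Lemma moves_tail n (p q : bpath B n.+1) F : moves p F q ->
  [exists r, moves (ptail p) F r] = (phead p == phead q) && moves (ptail p) F (ptail q).
Proof.
move=> m; apply/existsP/andP => [[r mr]|[_ mr]]; last by exists (ptail q).
have [q' [hq' tq' m']] := moves_cons_ex mr.
by rewrite (moves_fun m m') hq' tq'.
Qed.

(** Closing the connectors under inversion adds nothing: by [moves_tail], an edge is inherited from
    the lower level exactly when its inverse is. *)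
Lemma connects_moves n (p q : bpath B n.+1) F :
  connects linv (moves_conn n) p F q =
  moves p F q && ~~ [exists r, moves (ptail p) F r].
Proof.
rewrite /connects !inE /= moves_invE; case: (boolP (moves p F q)) => //= m.
have m' : moves q (linv F) p by rewrite moves_invE.
by rewrite (moves_tail m) (moves_tail m') moves_invE eq_sym orbb.
Qed.

Lemma connects_moves_out n (p : bpath B n.+1) F :
  ~~ [exists r, moves (ptail p) F r] && ~~ [exists q, connects linv (moves_conn n) p F q]
  = ~~ [exists q, moves p F q].
Proof.
rewrite -negb_or; congr negb; apply/orP/existsP => [[/existsP[r mr]|/existsP[q]]|[q m]].
- by have [q [_ _ m]] := moves_cons_ex mr; exists q.
- by rewrite connects_moves => /andP[m _]; exists q.
- case: (boolP [exists r, moves (ptail p) F r]) => h; [by left|right].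
  by apply/existsP; exists q; rewrite connects_moves m.
Qed.

Lemma moves_exists_inv n (p : bpath B n) F :
  [exists q, moves q F p] = [exists q, moves p (linv F) q].
Proof. by apply: eq_existsb => q; rewrite moves_invE. Qed.

Lemma connects_sym n (P : {set connector B L n}) p F q :
  connects linv P p F q = connects linv P q (linv F) p.
Proof. by rewrite /connects linvK orbC. Qed.

(** Every edge is either inherited or a connector, so the graphs defined by the action obey the
    inflation rule. *)
Lemma inflate_moves n : inflate linv (moves_tile n) (moves_conn n) = moves_tile n.+1.
Proof.
apply/setP => -[[[p|] F] [q|]]; rewrite !inE //.
- rewrite connects_moves; case: (boolP (moves p F q)) => m /=.
    by rewrite (moves_tail m) orbN.
  by rewrite orbF; apply: contraNF m => /andP[/eqP e m]; exact: moves_cons.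
- exact: connects_moves_out.
- rewrite !moves_exists_inv -connects_moves_out; congr (_ && ~~ _).
  by apply: eq_existsb => p; rewrite connects_sym.
Qed.

Lemma tiles_moves n : tiles linv (moves_tile 0) moves_conn n = moves_tile n.
Proof. by elim: n => [//|n /= ->]; exact: inflate_moves. Qed.

Hypothesis linv_neq : forall F, linv F != F.

Lemma moves_well_labeled n : well_labeled linv (tiles linv (moves_tile 0) moves_conn n).
Proof.
rewrite tiles_moves; split.
- by move=> F; rewrite inE.
- move=> [a|] F [b|]; rewrite !inE //.
  + by rewrite moves_invE.
  + by rewrite moves_exists_inv linvK.
  + by rewrite moves_exists_inv.
(* A loop has the same endpoints as its inverse; it is told apart by its label, hence the need for
   [linv] to be free of fixed points. *)
- by move=> a F b _ [_ e _]; have := linv_neq F; rewrite e eqxx.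
- move=> v F [b|] [b'|]; rewrite !inE //.
  + by move=> m m'; rewrite (moves_fun m m').
  + by move=> m /existsPn/(_ b); rewrite m.
  + by move=> /existsPn/(_ b') h m; rewrite m in h.
- move=> v F [a|] [a'|]; rewrite !inE //.
  + rewrite -!(@moves_invE _ _ _ v) => m m'; by rewrite (moves_fun m m').
  + by move=> m /existsPn/(_ a); rewrite m.
  + by move=> /existsPn/(_ a') h m; rewrite m in h.
Qed.

Lemma moves_base_tile (p : bpath B 0) F q :
  (Some p, F, Some q) \in moves_tile 0 -> pend p = pend q.
Proof. by rewrite inE => /moves_pend. Qed.

Lemma moves_conn_tile n (p q : bpath B n.+1) F : (p, q, F) \in moves_conn n ->
  [/\ pend p = pend q,
      (Some (ptail p), F, None) \in tiles linv (moves_tile 0) moves_conn n &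
      (None, F, Some (ptail q)) \in tiles linv (moves_tile 0) moves_conn n].
Proof.
rewrite tiles_moves !inE /= => /andP[m h]; split=> //; first exact: moves_pend m.
have m' : moves q (linv F) p by rewrite moves_invE.
by rewrite moves_exists_inv (moves_tail m') moves_invE eq_sym -(moves_tail m).
Qed.

(** This is not automatic; it is achieved by passing to the diagram of components, in
    [comp_diagram_connected]. *)
Hypothesis conn : forall n (p q : bpath B n), pend p = pend q -> connect (@moves_adj n) p q.

Lemma moves_connected n (p q : bpath B n) : pend p = pend q ->
  connect (adjacent (tiles linv (moves_tile 0) moves_conn n)) p q.
Proof.
move=> /conn; rewrite tiles_moves; apply: connect_sub => {}p {}q /existsP[F m].
by apply: connect1; apply/existsP; exists F; rewrite inE.
Qed.

Definition moves_inflation : tile_inflation B :=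
  TileInflation linvK moves_base_tile moves_conn_tile moves_well_labeled moves_connected.

Lemma tile_moves n : tile moves_inflation n = moves_tile n.
Proof. exact: tiles_moves. Qed.

Lemma moves_boundary n (p : bpath B n) :
  is_boundary (tile moves_inflation n) p -> unsettled p.
Proof.
rewrite tile_moves => /existsP[F]; rewrite !inE => /orP[h|].
  by apply/existsP; exists F.
by rewrite moves_exists_inv => h; apply/existsP; exists (linv F).
Qed.

Hypothesis s_cont : forall F, continuous (s F).

Lemma moves_act_tile F (x y : Omega B) :
  itile_edge (T := moves_inflation) x x F y -> Some (s F x) = Some y.
Proof.
move=> [n [_ t]]; rewrite tile_moves inE => /movesP/(_ x erefl)[e t'].
by congr Some; apply: (eq_trunc_tail e); apply: (same_tail_trans t'); apply: same_tail_sym.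
Qed.

Lemma moves_act_boundary F (x y : Omega B) : Some (s F x) = Some y ->
  itile_edge (T := moves_inflation) x x F y \/ iboundary moves_inflation x.
Proof.
move=> [<-]; have [h|] := pselect (exists n, [exists q, moves (trunc x n) F q]).
  have [n /existsP[q m]] := h; left; exists n; have [e t] := movesP _ _ _ m x erefl.
  by split=> //; rewrite tile_moves inE e.
move=> h; right => n; apply/existsP; exists F; rewrite tile_moves inE.
by apply/orP; left; apply/negP => m; apply: h; exists n.
Qed.

Lemma pdom_total (X : topologicalType) (f : X -> X) : pdom (fun x => Some (f x)) = setT.
Proof. by apply/seteqP. Qed.

Lemma moves_act_homeo F : partial_homeo (fun x => Some (s F x)) (fun x => Some (s (linv F) x)).
Proof.
split.
- by rewrite !pdom_total; split; exact: openT.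
- by split; apply: continuous_subspaceT; exact: s_cont.
- move=> x y; split=> -[<-]; first by rewrite sK.
  by rewrite -{1}(linvK F) sK.
Qed.

Lemma moves_act_clopen F : clopen (pdom (fun x => Some (s F x))).
Proof. by rewrite pdom_total; exact: clopenT. Qed.

Definition moves_action : label_action moves_inflation :=
  @LabelAction _ moves_inflation (fun F x => Some (s F x))
    moves_act_tile moves_act_boundary moves_act_homeo moves_act_clopen.

Lemma moves_perfectly_labeled : perfectly_labeled moves_action.
Proof.
have actG F : label_semigroup moves_action (fun x => Some (s F x)) by apply: gen_in; exists F.
have orb x y F : orbit_of (label_semigroup moves_action) x y ->
    orbit_of (label_semigroup moves_action) x (s F y).
  by move=> [g Gg gx]; exists (Defs.pcomp g (fun x => Some (s F x))); [exact: gen_comp Gg (actG F)|by rewrite /Defs.pcomp gx].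
move=> x y F Oxy; split.
  exists (s F y); split; first by split=> //; exact: orb.
  by move=> z [_ _ [->]].
exists (s (linv F) y); split.
  split=> //; first exact: orb.
  by rewrite /= -{1}(linvK F) sK.
by move=> z [_ _ [<-]]; rewrite sK.
Qed.

Lemma moves_bounded (N : nat) :
  (forall n, #|[set p : bpath B n | unsettled p]%SET| <= N) ->
  (exists M, forall n, #|vert B n| <= M /\ #|edge B n| <= M) ->
  bounded_type moves_inflation.
Proof.
move=> bN bB; split=> //.
  exists N => n v; apply: leq_trans (bN n); apply: subset_leq_card.
  by apply/fintype.subsetP => p; rewrite !inE => /andP[_ /moves_boundary].
apply: (@finite_of_trunc _ _ N (fun n => [set p : bpath B n | unsettled p]%SET)) => // x n bx.
by rewrite inE; exact/moves_boundary/bx.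
Qed.

End Moves.

(** * Splitting the vertices of a Bratteli diagram *)

Section Refine.
Variables (B : bratteli) (cls : forall n, bpath B n -> bpath B n).
(** [cls] picks representatives of an equivalence on the paths of each length. [cls_pend] tells
    which edges can follow a class, and [cls_cons] makes the class reached by such an edge well
    defined. *)
Hypotheses (clsK : forall n (p : bpath B n), cls (cls p) = cls p)
  (cls_pend : forall n (p : bpath B n), pend (cls p) = pend p)
  (cls_cons : forall n (p q : bpath B n.+1), phead p = phead q ->
    cls (ptail p) = cls (ptail q) -> cls p = cls q).

(* A class is encoded by its representative, a fixed point of [cls]. *)
Definition class n : finType := {p : bpath B n | cls p == p}.

Definition class_of n (p : bpath B n) : class n := exist _ (cls p) (introT eqP (clsK p)).

Lemma class_of_val n (C : class n) : class_of (val C) = C.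
Proof. by apply: val_inj; exact: (eqP (valP C)). Qed.

Lemma class_of_eq n (p q : bpath B n) : class_of p = class_of q <-> cls p = cls q.
Proof. by split=> [/(congr1 val)//|e]; apply: val_inj. Qed.

(** The shift of index comes from [class m] being made of paths of length m+1, which end at the
    vertices of index m+1. *)
Definition rvert n : finType := if n is m.+1 then class m else vert B 0.

Definition redge n : finType :=
  if n is m.+1 then {u : edge B m.+1 * class m | src u.1 == pend (val u.2)} else edge B 0.

Definition rsrc n : redge n -> rvert n :=
  match n with
  | 0 => fun e => src e
  | m.+1 => fun u => (val u).2
  end.

Definition rrng n : redge n -> rvert n.+1 :=
  match n with
  | 0 => fun e => @class_of 0 e
  | m.+1 => fun u => class_of (bcons (valP u))
  end.

Lemma redge_subproof n (e : edge B n.+1) (p : bpath B n) :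
  src e = pend p -> src (e, class_of p).1 == pend (val (e, class_of p).2).
Proof. by move=> ->; rewrite /= cls_pend. Qed.

Definition redge_of n (e : edge B n.+1) (p : bpath B n) (h : src e = pend p) : redge n.+1 :=
  exist _ (e, class_of p) (redge_subproof h).

Lemma rsrc_surj n (v : rvert n) : exists e : redge n, rsrc e = v.
Proof.
case: n v => [|n] v; first exact: src_surj.
have [e es] := src_surj (pend (val v)).
by exists (redge_of es); exact: class_of_val.
Qed.

Lemma rrng_redge_of n (p : bpath B n.+1) :
  @rrng n.+1 (redge_of (src_phead p)) = class_of p.
Proof. by apply/class_of_eq; apply: cls_cons => //=; exact: clsK. Qed.

Lemma rrng_surj n (v : rvert n.+1) : exists e : redge n, rrng e = v.
Proof.
case: n v => [|n] v; first by exists (val v); exact: class_of_val.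
by exists (redge_of (src_phead (val v))); rewrite rrng_redge_of class_of_val.
Qed.

Definition refined : bratteli := Bratteli rsrc_surj rrng_surj.

Definition forget_edge n : edge refined n -> edge B n :=
  match n with
  | 0 => fun e => e
  | m.+1 => fun u => (val u).1
  end.

Lemma rng_forget_edge n (u : edge refined n) :
  rng (forget_edge u) = pend (val (rng u : class n)).
Proof. by case: n u => [|n] u; rewrite /= cls_pend. Qed.

Lemma forget_subproof (x : Omega refined) n :
  rng (forget_edge (iedge x n)) = src (forget_edge (iedge x n.+1)).
Proof. by rewrite rng_forget_edge iedge_comp (eqP (valP (iedge x n.+1))). Qed.

Definition forget (x : Omega refined) : Omega B := ipath_of (forget_subproof x).

Lemma src_iedgeS (x : Omega B) n : src (iedge x n.+1) = pend (trunc x n).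
Proof. by rewrite pend_trunc iedge_comp. Qed.

Definition refine_edge (x : Omega B) n : edge refined n :=
  match n with
  | 0 => iedge x 0
  | m.+1 => redge_of (src_iedgeS x m)
  end.

Lemma rng_refine_edge x n : rng (refine_edge x n) = class_of (trunc x n) :> class n.
Proof.
case: n => [//|n]; apply/class_of_eq; apply: cls_cons => //=; exact: clsK.
Qed.

Lemma refine_subproof x n : rng (refine_edge x n) = src (refine_edge x n.+1).
Proof. exact: rng_refine_edge. Qed.

Definition refine_path (x : Omega B) : Omega refined := ipath_of (refine_subproof x).

(** The class components of the edges leave no freedom: by induction they are forced by the
    underlying path, which makes [forget] injective. *)
Lemma rng_iedge_refined (x : Omega refined) n :
  rng (iedge x n) = class_of (trunc (forget x) n) :> class n.
Proof.
elim: n => [//|n IH]; apply/class_of_eq; apply: cls_cons => //=.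
by apply/class_of_eq; rewrite -IH class_of_val iedge_comp.
Qed.

Lemma pend_refined (x : Omega refined) n :
  pend (trunc x n) = class_of (trunc (forget x) n) :> class n.
Proof. by rewrite pend_trunc; exact: rng_iedge_refined. Qed.

Lemma refineK : cancel refine_path forget.
Proof. by move=> x; apply: iedge_inj; case. Qed.

Lemma forgetK : cancel forget refine_path.
Proof.
move=> x; apply: iedge_inj => -[//|n]; apply: val_inj.
rewrite [RHS]surjective_pairing; congr pair.
by rewrite -[RHS]/(src (iedge x n.+1)) -iedge_comp rng_iedge_refined.
Qed.

Lemma forget_trunc x y n :
  trunc x n = trunc y n -> trunc (forget x) n = trunc (forget y) n.
Proof.
by move=> /trunc_eqP e; apply/trunc_eqP => i ni; rewrite !iedge_ipath_of (e i ni).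
Qed.

Lemma eq_refine_edge x y n : trunc x n = trunc y n -> refine_edge x n = refine_edge y n.
Proof.
case: n => [//|n] e; apply: val_inj; congr (_, class_of _).
  exact: (congr1 (@phead _ _) e).
exact: (congr1 (@ptail _ _) e).
Qed.

Lemma refine_trunc x y n :
  trunc x n = trunc y n -> trunc (refine_path x) n = trunc (refine_path y) n.
Proof.
move=> e; apply/trunc_eqP => i ni; rewrite !iedge_ipath_of.
exact/eq_refine_edge/(trunc_le ni).
Qed.

(** Classes that agree at level [n] still agree after the same edges are appended, so the later
    refined edges coincide in both components. *)
Lemma refine_tail x y n : same_tail n x y -> cls (trunc x n) = cls (trunc y n) ->
  same_tail n (refine_path x) (refine_path y).
Proof.
move=> e c; have cE m : n <= m -> cls (trunc x m) = cls (trunc y m).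
  elim: m => [|m IH]; first by rewrite leqn0 => /eqP n0; rewrite n0 in c.
  rewrite leq_eqVlt ltnS => /predU1P[nm|nm]; first by rewrite nm in c.
  by apply: cls_cons; [exact: e|exact: IH].
case=> [//|i] ni; rewrite !iedge_ipath_of; apply: val_inj; congr pair; first exact: e.
exact/class_of_eq/cE.
Qed.

Lemma refine_homeo : homeo_pair forget refine_path.
Proof.
split; [| |exact: forgetK|exact: refineK]; apply: continuous_ipath => x n.
  by have := near_iedge n x; apply: filterS => y e; rewrite !iedge_ipath_of e.
by have := near_trunc n x; apply: filterS => y e; rewrite !iedge_ipath_of; exact: eq_refine_edge.
Qed.

Lemma card_redge n : #|edge refined n.+1| <= #|edge B n.+1| * #|vert refined n.+1|.
Proof. by rewrite -card_prod; exact: (leq_card _ val_inj). Qed.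

End Refine.

Lemma label_semigroup_inv (B : bratteli) (T : tile_inflation B) (a : label_action T) f :
  label_semigroup a f ->
  exists2 g, label_semigroup a g & forall x y, f x = Some y <-> g y = Some x.
Proof.
elim=> [|_ [F _ <-]|{}f f' _ [g Gg gP] _ [g' Gg' gP']].
- by exists (fun x => Some x) => [|x y]; [exact: gen_id|split=> -[->]].
- exists (act a (ti_inv F)); first by apply: gen_in; exists (ti_inv F).
  by case: (act_homeo a F).
- exists (Defs.pcomp g' g); first exact: gen_comp.
  move=> x y; rewrite /Defs.pcomp; split.
    by case fx: (f x) => [z|] //= /gP' ->; apply/gP.
  by case gy: (g' y) => [z|] //= /gP ->; apply/gP'.
Qed.

(** * The diagram of connected components *)

Section RefineMoves.
Variables (B : bratteli) (L : finType) (linv : L -> L) (s : L -> Omega B -> Omega B).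
Hypotheses (linvK : involutive linv) (linv_neq : forall F, linv F != F)
  (sK : forall F, cancel (s F) (s (linv F))) (s_cont : forall F, continuous (s F)).

Definition comp_root n (p : bpath B n) : bpath B n := root (@moves_adj B L s n) p.

Lemma comp_rootP n (p q : bpath B n) :
  comp_root p = comp_root q <-> connect (@moves_adj B L s n) p q.
Proof.
have cs := @moves_adj_connect_sym B L s linv sK n.
by rewrite -(root_connect cs); split=> [/eqP|/eqP].
Qed.

Lemma comp_rootK n (p : bpath B n) : comp_root (comp_root p) = comp_root p.
Proof. exact/root_root/(moves_adj_connect_sym sK). Qed.

Lemma connect_moves_pend n (p q : bpath B n) :
  connect (@moves_adj B L s n) p q -> pend p = pend q.
Proof.
move=> /connectP[w]; elim: w p => [|r w IH] p /=; first by move=> _ ->.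
by case/andP => /existsP[F /moves_pend ->] wP lE; exact: IH.
Qed.

Lemma comp_root_pend n (p : bpath B n) : pend (comp_root p) = pend p.
Proof. by apply/esym/connect_moves_pend/comp_rootP; rewrite comp_rootK. Qed.

Lemma comp_root_cons n (p q : bpath B n.+1) : phead p = phead q ->
  comp_root (ptail p) = comp_root (ptail q) -> comp_root p = comp_root q.
Proof. by move=> e /comp_rootP c; apply/comp_rootP; exact: moves_adj_cons c. Qed.

Definition comp_diagram : bratteli := refined comp_rootK comp_root_pend comp_root_cons.

Let up : Omega B -> Omega comp_diagram := @refine_path B comp_root _ _ _.
Let down : Omega comp_diagram -> Omega B := @forget B comp_root _ _ _.

Let upK : cancel up down. Proof. exact: refineK. Qed.
Let downK : cancel down up. Proof. exact: forgetK. Qed.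
Let down_up_homeo : homeo_pair down up. Proof. exact: refine_homeo. Qed.

Definition lift_gen F : Omega comp_diagram -> Omega comp_diagram := up \o s F \o down.

Lemma lift_genK F : cancel (lift_gen F) (lift_gen (linv F)).
Proof. by move=> x; rewrite /lift_gen /= upK sK downK. Qed.

Lemma lift_gen_cont F : continuous (lift_gen F).
Proof.
have [dc uc _ _] := down_up_homeo.
by move=> x; apply: continuous_comp; [exact: dc|apply: continuous_comp; [exact: s_cont|exact: uc]].
Qed.

Let ext (D : bratteli) n (p : bpath D n) : Omega D := sval (cid (trunc_surj p)).
Let extK (D : bratteli) n (p : bpath D n) : trunc (ext p) n = p.
Proof. exact: svalP (cid (trunc_surj p)). Qed.

(** Finite paths are transported through an arbitrary infinite extension; by [refine_trunc] and
    [forget_trunc] its choice does not matter. *)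
Definition up_path n (p : bpath B n) : bpath comp_diagram n := trunc (up (ext p)) n.
Definition down_path n (p : bpath comp_diagram n) : bpath B n := trunc (down (ext p)) n.

Lemma trunc_up x n : trunc (up x) n = up_path (trunc x n).
Proof. by apply: refine_trunc; rewrite extK. Qed.

Lemma trunc_down x n : trunc (down x) n = down_path (trunc x n).
Proof. by apply: forget_trunc; rewrite extK. Qed.

Lemma up_pathK n : cancel (@up_path n) (@down_path n).
Proof. by move=> p; rewrite -(extK p) -trunc_up -trunc_down upK. Qed.

Lemma down_pathK n : cancel (@down_path n) (@up_path n).
Proof. by move=> p; rewrite -(extK p) -trunc_down -trunc_up downK. Qed.

(** Both ends of an edge lie in one component, so [refine_tail] shows that the lifted generator also
    preserves the refined tail. *)
Lemma moves_up n (p : bpath B n) F q : moves s p F q -> moves lift_gen (up_path p) F (up_path q).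
Proof.
move=> m; apply/movesP => x xp.
have [|e t] := movesP _ _ _ _ m (down x); first by rewrite trunc_down xp up_pathK.
rewrite trunc_up e; split=> //; rewrite -{2}(downK x); apply: refine_tail => //.
apply/comp_rootP; rewrite e trunc_down xp up_pathK (moves_adj_connect_sym sK).
by apply: connect1; apply/existsP; exists F.
Qed.

Lemma connect_up n (p q : bpath B n) : connect (@moves_adj B L s n) p q ->
  connect (@moves_adj comp_diagram L lift_gen n) (up_path p) (up_path q).
Proof.
move=> /connectP[w]; elim: w p => [|r w IH] p /=; first by move=> _ ->.
case/andP => /existsP[F m] wP lE; apply: connect_trans (IH _ wP lE).
by apply: connect1; apply/existsP; exists F; exact: moves_up.
Qed.

(** A common end vertex upstairs means a common component downstairs, and a chain of moves within
    that component lifts. *)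
Lemma comp_diagram_connected n (p q : bpath comp_diagram n) :
  pend p = pend q -> connect (@moves_adj comp_diagram L lift_gen n) p q.
Proof.
rewrite -{1}(extK p) -{1}(extK q) !pend_refined => /class_of_eq/comp_rootP/connect_up.
by rewrite !trunc_down !extK !down_pathK.
Qed.

Lemma unsettled_down n (p : bpath comp_diagram n) :
  unsettled lift_gen p -> unsettled s (down_path p).
Proof.
move=> /existsP[F h]; apply/existsP; exists F; apply: contra h => /existsP[q m].
by apply/existsP; exists (up_path q); rewrite -(down_pathK p); exact: moves_up.
Qed.

Lemma card_unsettled_lift n :
  #|[set p : bpath comp_diagram n | unsettled lift_gen p]%SET| <=
  #|[set p : bpath B n | unsettled s p]%SET|.
Proof.
rewrite -(card_imset _ (can_inj (@down_pathK n))); apply: subset_leq_card.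
by apply/fintype.subsetP => _ /imsetP[p + ->]; rewrite !inE; exact: unsettled_down.
Qed.

Lemma comp_diagram_bounded M : (forall n, #|vert B n| <= M /\ #|edge B n| <= M) ->
  (forall n, #|class (@comp_root) n| <= M) ->
  exists M', forall n, #|vert comp_diagram n| <= M' /\ #|edge comp_diagram n| <= M'.
Proof.
(* The product counts the refined edges of positive index, which are pairs of an edge of [B] and a
   class. *)
move=> bB bC; exists (M + M * M) => -[|n]; split.
- exact/(leq_trans (bB 0).1)/leq_addr.
- exact/(leq_trans (bB 0).2)/leq_addr.
- exact/(leq_trans (bC n))/leq_addr.
- apply: leq_trans (card_redge _ _ _ n) _; apply: leq_trans (leq_addl _ _).
  by apply: leq_mul; [exact: (bB n.+1).2|exact: bC].
Qed.

Variable G : set (Omega B -> Omega B).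
Hypotheses (Ggroup : homeo_group G) (Gs : forall F, G (s F))
  (Gmin : forall H, homeo_group H -> (forall F, H (s F)) -> G `<=` H).

Lemma generated_bounded_type_group N M :
  (forall n, #|[set p : bpath B n | unsettled s p]%SET| <= N) ->
  (forall n, #|vert B n| <= M /\ #|edge B n| <= M) ->
  (forall n, #|class (@comp_root) n| <= M) ->
  bounded_type_group G.
Proof.
move=> bN bB bC.
pose a := moves_action linvK lift_genK linv_neq comp_diagram_connected lift_gen_cont.
have [G_homeo G1 GM _] := Ggroup.
have semiG f' : label_semigroup a f' ->
    exists2 f, G f & f' = (fun x => Some (up (f (down x)))).
  elim=> [|_ [F _ <-]|_ _ _ [f Gf ->] _ [g Gg ->]].
  - by exists id => //; apply: funext => x; rewrite downK.
  - by exists (s F).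
  - by exists (g \o f); [exact: GM|apply: funext => x; rewrite /Defs.pcomp /= upK].
have semiG' f : label_semigroup a (fun x => Some (up (f (down x)))) -> G f.
  move=> /semiG[f1 Gf1 e]; suff -> : f = f1 by [].
  apply: funext => x; have := congr1 (@^~ (up x)) e => /Some_inj.
  by rewrite upK => e'; exact: (can_inj upK e').
exists comp_diagram, (moves_inflation linvK lift_genK linv_neq comp_diagram_connected), a, down, up.
split.
- apply: moves_bounded (comp_diagram_bounded bB bC) => n.
  exact: leq_trans (card_unsettled_lift n) (bN n).
- exact: moves_perfectly_labeled.
- exact: down_up_homeo.
move=> f; split; last exact: semiG'.
(* The homeomorphisms whose lift lies in the semigroup form a group containing the generators, hence
   containing [G]. *)
apply: (Gmin (H := [set f | label_semigroup a (fun x => Some (up (f (down x))))])); last first.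
  by move=> F; apply: gen_in; exists F.
split.
- by move=> g /semiG'; exact: G_homeo.
- rewrite /= (_ : (fun x => _) = (fun x => Some x)); first exact: gen_id.
  by apply: funext => x; rewrite downK.
- move=> g1 g2 /= h1 h2; have := gen_comp h1 h2.
  by congr generated_pmap; apply: funext => x; rewrite /Defs.pcomp /= upK.
- move=> g1 g2 /= h1 [_ _ _ gK]; have [g' h' gP] := label_semigroup_inv h1.
  rewrite (_ : (fun x => _) = g') //; apply: funext => y; apply/esym/gP.
  by rewrite upK gK downK.
Qed.

End RefineMoves.

Lemma card_bigcup_le (I V : finType) (U : I -> {set V}) :
  #|(\bigcup_i U i)%SET| <= \sum_i #|U i|.
Proof.
elim/big_ind2: _ => [|A k A' k' h h'|//]; first by rewrite finset.cards0.
by apply: leq_trans (leq_add h h'); rewrite cardsU leq_subr.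
Qed.

(** * Counting unsettled paths *)

Section Settled.
Variable B : bratteli.

Definition settled (f : Defs.pmap (Omega B)) n (p : bpath B n) : Prop :=
  (forall x, trunc x n = p -> f x = None) \/
  exists q, forall x, trunc x n = p -> exists y, [/\ f x = Some y, trunc y n = q & same_tail n y x].

Definition unsettled_set (f : Defs.pmap (Omega B)) n : {set bpath B n} :=
  [set p | `[< ~ settled f p >]]%SET.

Lemma unsettled_setP f n (p : bpath B n) : p \notin unsettled_set f n <-> settled f p.
Proof.
rewrite inE; split; first by move/asboolPn/contrapT.
by move=> h; apply/asboolPn; apply.
Qed.

Lemma card_unsettled_comp (f g : Defs.pmap (Omega B)) n :
  (forall x x' y, f x = Some y -> f x' = Some y -> x = x') ->
  #|unsettled_set (Defs.pcomp f g) n| <= #|unsettled_set f n| + #|unsettled_set g n|.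
Proof.
move=> fI; set Ufg := unsettled_set (Defs.pcomp f g) n.
set Uf := unsettled_set f n; set Ug := unsettled_set g n.
(* [f] injects the paths that become unsettled only under [g] into those
   unsettled for [g]. *)
have /choice[t tP] (p : bpath B n) : exists q, p \in Ufg :\: Uf -> q \in Ug /\
    forall x, trunc x n = p -> exists y, [/\ f x = Some y, trunc y n = q & same_tail n y x].
  case: (boolP (p \in Ufg :\: Uf)) => [|_]; last by exists p.
  rewrite finset.in_setD => /andP[/unsettled_setP fp]; rewrite inE => /asboolP fgp.
  case: fp => [fN|[q fq]].
    by case: fgp; left => x /fN fx; rewrite /Defs.pcomp fx.
  exists q => _; split=> //; apply/negPn/negP => /unsettled_setP gq; apply: fgp.
  case: gq => [gN|[r gr]].
    by left => x /fq[y [fx yq _]]; rewrite /Defs.pcomp fx /=; exact: gN.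
  right; exists r => x /fq[y [fx yq yx]]; have [z [gy zr zy]] := gr _ yq.
  by exists z; rewrite /Defs.pcomp fx; split=> //; exact: same_tail_trans yx.
rewrite -(cardsID Uf Ufg); apply: leq_add; first exact/subset_leq_card/finset.subsetIr.
rewrite -(@card_in_imset _ _ t (Ufg :\: Uf)).
  by apply/subset_leq_card/fintype.subsetP => _ /imsetP[p /tP[tp _] ->].
(* Injectivity of [t]: if [p] and [p'] had the same image, the points over them with a common tail
   would have the same value under [f], hence coincide. *)
move=> p p' /tP[_ hp] /tP[_ hp'] e; rewrite -{}e in hp'.
have [x xp] := trunc_surj p; have [y [fx yt yx]] := hp x xp.
have [x0 x0p] := trunc_surj p'; have [y0 [_ y0t y0x]] := hp' x0 x0p.
have [|x' [x'p xx']] := @splice _ _ p' x.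
  by rewrite -x0p -(pend_same_tail y0x) y0t -yt (pend_same_tail yx).
have [y' [fx' y't y'x]] := hp' x' x'p.
have e : y' = y.
  apply: (@eq_trunc_tail _ n); first by rewrite y't yt.
  by apply: (same_tail_trans y'x); apply: (same_tail_trans xx'); exact: same_tail_sym.
by rewrite -xp -x'p (fI _ _ _ fx (etrans fx' (congr1 Some e))).
Qed.

(** Compactness of the path space: were there no common level, counterexamples would accumulate
    along an infinite path, against the hypothesis on that path. *)
Lemma koenig (P : forall n, bpath B n -> Prop) :
  (forall x n m, n <= m -> P n (trunc x n) -> P m (trunc x m)) ->
  (forall x, exists n, P n (trunc x n)) -> exists n, forall p : bpath B n, P n p.
Proof.
move=> Pm Px; apply: contrapT => nP.
have {}nP n : exists x, ~ P n (trunc x n).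
  apply: contrapT => h; apply: nP; exists n => p; have [x <-] := trunc_surj p.
  by apply: contrapT => nPx; apply: h; exists x.
(* [Q n p]: the cylinder of [p] contains counterexamples at every later level. *)
pose Q n (p : bpath B n) := forall m, n <= m -> exists x, trunc x n = p /\ ~ P m (trunc x m).
have Q0 : exists p, Q 0 p.
  apply: contrapT => h.
  have [|p|m mP] := @uniform_level _ (fun (p : bpath B 0) m => forall x, trunc x 0 = p -> P m (trunc x m)).
  - by move=> p n m nm h' x /h'; exact: Pm.
  - apply: contrapT => h'; apply: h; exists p => m _; apply: contrapT => h2; apply: h'.
    by exists m => x xp; apply: contrapT => nPx; apply: h2; exists x.
  - by have [x] := nP m; apply; exact: (mP (trunc x 0)).
have QS n (p : {p : bpath B n | Q n p}) : {p' : {p : bpath B n.+1 | Q n.+1 p} | ptail (sval p') = sval p}.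
  apply: cid; case: p => p Qp /=; apply: contrapT => h.
  have [|p'|m mP] := @uniform_level _ (fun (p' : bpath B n.+1) m => ptail p' = p ->
      forall x, trunc x n.+1 = p' -> P m (trunc x m)).
  - by move=> p' k m km h' e x /(h' e); exact: Pm.
  - apply: contrapT => h'; apply: h.
    suff Qp' : ptail p' = p /\ Q n.+1 p' by exists (exist _ p' Qp'.2); exact: Qp'.1.
    split.
      by apply: contrapT => e; apply: h'; exists 0 => /e.
    move=> m _; apply: contrapT => h2; apply: h'.
    by exists m => _ x xp; apply: contrapT => nPx; apply: h2; exists x.
  - have [x [xp nPx]] := Qp (maxn n m) (leq_maxl _ _); apply: nPx.
    apply: (Pm _ m); first exact: leq_maxr.
    exact: (mP (trunc x n.+1)).
pose r := fix r n : {p : bpath B n | Q n p} :=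
  match n with
  | 0 => let: exist p h := cid Q0 in exist _ p h
  | m.+1 => sval (QS m (r m))
  end.
have [n|x xP] := @ipath_lim B (fun n => sval (r n)); first exact: (svalP (QS n (r n))).
have [n Pn] := Px x; have [y []] := svalP (r n) n (leqnn n).
by rewrite -xP => -> /(_ Pn).
Qed.

Lemma card_unsettled_full (G0 : set (Defs.pmap (Omega B))) f :
  (forall g, G0 g -> exists C, forall n, #|unsettled_set g n| <= C) ->
  full_group G0 f -> exists C, forall n, #|unsettled_set (fun x => Some (f x)) n| <= C.
Proof.
move=> G0C [_ fG].
have [||N NP] := @koenig (fun n p => exists2 g, G0 g & forall x, trunc x n = p -> g x = Some (f x)).
- move=> x n m nm [g Gg gf]; exists g => // y ym; apply: gf; exact: trunc_le ym.
- by move=> x; have [g Gg /nbhs_trunc[n gf]] := fG x; exists n, g.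
have /choice[c cP] (p : bpath B N) : exists c, exists2 g, (forall n, #|unsettled_set g n| <= c) &
    forall x, trunc x N = p -> g x = Some (f x).
  by have [g /G0C[c cP] gf] := NP p; exists c, g.
(* Below level [N] all paths are counted. From [N] on, [f] agrees on each cylinder of level [N] with
   some [g p], so a path unsettled for [f] is unsettled for one of these. *)
exists (\sum_(n < N) #|bpath B n| + \sum_p c p) => n.
case: (ltnP n N) => nN.
  apply: leq_trans (max_card _) _; apply: leq_trans (leq_addr _ _).
  by rewrite (bigD1 (Ordinal nN)) //= leq_addr.
apply: leq_trans (leq_addl _ _).
have {cP} /choice[g gP] p : exists g, (forall n, #|unsettled_set g n| <= c p) /\
    forall x, trunc x N = p -> g x = Some (f x).
  by have [g g1 g2] := cP p; exists g.
apply: (@leq_trans #|(\bigcup_p unsettled_set (g p) n)%SET|).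
  apply: subset_leq_card; apply/fintype.subsetP => p.
  apply: contraLR => /finset.bigcupP h; apply/unsettled_setP; right.
  have [x xp] := trunc_surj p.
  have /unsettled_setP[gN|[q qP]] : p \notin unsettled_set (g (trunc x N)) n.
  + by apply/negP => h'; apply: h; exists (trunc x N).
  + by have := gN x xp; rewrite (gP _).2.
  + exists q => y yp; have [z [gy zq zy]] := qP y yp.
    rewrite (gP _).2 in gy; last by apply: trunc_le nN _; rewrite yp xp.
    by exists z.
apply: (@leq_trans (\sum_p #|unsettled_set (g p) n|)).
  exact: card_bigcup_le.
by apply: leq_sum => p _; exact: (gP p).1.
Qed.

(** Since the classes are finite, beyond some level [n] all members of a class agree with its
    representative. Different representatives still differ beyond [n], all of them before a common
    level [m], and there they pass through different vertices. *)
Lemma card_tail_classes (I : finType) (y : I -> Omega B) M :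
  (forall n, #|vert B n| <= M) ->
  (forall i, finite_set [set z | exists n, same_tail n z (y i)]) ->
  (forall i j n, same_tail n (y i) (y j) -> i = j) -> #|I| <= M.
Proof.
move=> BM yfin yI.
have [||n nP] := @uniform_level I (fun i n => forall z m, same_tail m z (y i) -> same_tail n z (y i)).
- by move=> i n m nm h z k /h; exact: same_tail_le.
- move=> i; have /finite_seqP[l lE] := yfin i.
  have lP z : z \in l <-> exists n, same_tail n z (y i) by rewrite -[X in X <-> _]/([set` l] z) -lE.
  have [||n nP] := @uniform_level (seq_sub l) (fun z n => same_tail n (val z) (y i)).
  + by move=> z n m; exact: same_tail_le.
  + by move=> z; apply/lP; exact: valP.
  + exists n => z m /(ex_intro _ m)/lP zl; exact: (nP (SeqSub zl)).
have [||m mP] := @uniform_level (I * I)%type (fun u m => u.1 = u.2 \/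
    exists k, [/\ n < k, k <= m & iedge (y u.1) k <> iedge (y u.2) k]).
- move=> u k m km [?|[j [nj jk h]]]; [by left|right; exists j; split=> //].
  exact: leq_trans km.
- move=> [i j]; have [->|ij] := pselect (i = j); first by exists 0; left.
  have [[k [nk h]]|h] := pselect (exists k, n < k /\ iedge (y i) k <> iedge (y j) k).
    by exists k; right; exists k.
  case: ij; apply: (yI _ _ n) => k nk; apply: contrapT => h'; apply: h.
  by exists k.
apply: leq_trans (BM m.+1); apply: (leq_card (fun i => pend (trunc (y i) m))) => i j e.
have [//|[k [nk km h]]] := mP (i, j).
(* Two classes meeting at the level-[m] vertex could exchange their initial
   segments, although they differ between the levels [n] and [m]. *)
have [z [zi zj]] := splice e; case: h.
by rewrite /= -(nP _ _ _ zj) //; move/trunc_eqP: zi => ->.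
Qed.

End Settled.

(** * The labels of the given inflation *)

Section LabelAction.
Variables (B : bratteli) (T : tile_inflation B) (a : label_action T).

Lemma tile_pend n (p q : bpath B n) F : (Some p, F, Some q) \in tile T n -> pend p = pend q.
Proof.
case: n p q => [|n] p q; first exact: ti_base_tile.
rewrite inE => /orP[/andP[/eqP e _]|/orP[|]]; first by rewrite !pend_phead e.
  by case/ti_conn_tile.
by case/ti_conn_tile.
Qed.

(** Finite tiles are connected, and a chain of edges in a tile spells a product of labels. *)
Lemma same_tail_orbit n x z : same_tail n z x -> orbit_of (label_semigroup a) x z.
Proof.
move=> zx; have /connectP[w] := ti_connected T (esym (pend_same_tail zx)).
move: zx; elim: w x => [|r w IH] x zx /=.
  by move=> _ e; exists (fun x => Some x); [exact: gen_id|rewrite (eq_trunc_tail e zx)].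
case/andP => /existsP[F m] wP lE.
have [|x' [x'r x'x]] := @splice _ _ r x; first by rewrite (tile_pend m).
have [|||g Gg gz] := IH x'; rewrite ?x'r //.
  by apply: (same_tail_trans zx); exact: same_tail_sym.
have Fx : act a F x = Some x'.
  by apply: act_tile; exists n; split=> //; rewrite x'r.
exists (Defs.pcomp (act a F) g); last by rewrite /Defs.pcomp Fx.
by apply: gen_comp Gg; apply: gen_in; exists F.
Qed.

Lemma is_boundary_le x n m : n <= m ->
  is_boundary (tile T m) (trunc x m) -> is_boundary (tile T n) (trunc x n).
Proof.
elim: m => [|m IH]; first by rewrite leqn0 => /eqP ->.
rewrite leq_eqVlt ltnS => /predU1P[->//|nm] /existsP[F].
rewrite !inE => h; apply: (IH nm); apply/existsP; exists F.
by case/orP: h => /andP[-> _]; rewrite ?orbT.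
Qed.

Lemma tile_le x y F n m : n <= m -> same_tail n y x ->
  (Some (trunc x n), F, Some (trunc y n)) \in tile T n ->
  (Some (trunc x m), F, Some (trunc y m)) \in tile T m.
Proof.
elim: m => [|m IH]; first by rewrite leqn0 => /eqP ->.
rewrite leq_eqVlt ltnS => /predU1P[->//|nm] yx h.
by rewrite inE !phead_trunc yx ?ltnS // eqxx /= (IH nm yx h).
Qed.

(** An edge that does not descend comes from a connector, which joins points with boundary tails.
    Truncations of boundary points are again boundary points, so the truncation of [x] at level [n]
    would be one. *)
Lemma tile_ge x y F n m : n <= m -> same_tail m y x ->
  ~~ is_boundary (tile T n) (trunc x n) ->
  (Some (trunc x m), F, Some (trunc y m)) \in tile T m ->
  same_tail n y x /\ (Some (trunc x n), F, Some (trunc y n)) \in tile T n.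
Proof.
elim: m => [|m IH]; first by rewrite leqn0 => /eqP ->.
rewrite leq_eqVlt ltnS => /predU1P[->//|nm] yx nb.
have {}nb' : ~~ is_boundary (tile T m) (trunc x m) by apply: contra nb; exact: is_boundary_le.
rewrite inE => /orP[/andP[/eqP e h]|h].
  apply: IH => // i; rewrite leq_eqVlt => /predU1P[<-|]; [by rewrite -!phead_trunc|exact: yx].
case/negP: nb'; apply/existsP; case/orP: h => /ti_conn_tile[_ h h'].
  by exists F; rewrite h.
by exists (ti_inv F); rewrite h' orbT.
Qed.

(** If [F] is defined at one point over [p], its value there comes from an edge of the infinite
    tile, as [p] is not a boundary point. This edge is present at level [n], so it acts on the whole
    cylinder. *)
Lemma act_settled F n (p : bpath B n) :
  ~~ is_boundary (tile T n) p -> settled (act a F) p.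
Proof.
move=> nb; have [[x [y [xp Fx]]]|h] := pselect (exists x y, trunc x n = p /\ act a F x = Some y).
  right; exists (trunc y n).
  have [[m [_ yx h]]|/(_ n)] := act_boundary Fx; last by rewrite xp (negPf nb).
  have [yx' h'] : same_tail n y x /\ (Some (trunc x n), F, Some (trunc y n)) \in tile T n.
    case: (leqP m n) => mn; last by apply: tile_ge (ltnW mn) yx _ h; rewrite xp.
    by split; [exact: same_tail_le yx|exact: tile_le h].
  move=> x' x'p; have [|y' [y'y y'x']] := @splice _ _ (trunc y n) x'.
    by rewrite x'p -xp (pend_same_tail yx').
  exists y'; split=> //; apply: act_tile; exists n; split=> //.
  by rewrite x'p y'y -xp.
left=> x xp; case Fx: (act a F x) => [y|//]; case: h; by exists x, y.
Qed.

Lemma card_boundary : bounded_type T ->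
  exists C, forall n, #|[set p : bpath B n | is_boundary (tile T n) p]%SET| <= C.
Proof.
move=> [[N NP] _ [M MP]]; exists (M * N) => n.
apply: (@leq_trans (\sum_(v : vert B n.+1)
    #|[set p : bpath B n | (pend p == v) && is_boundary (tile T n) p]%SET|)).
  rewrite -sum1dep_card (partition_big (@pend B n) predT) //=.
  by apply: leq_sum => v _; rewrite -sum1dep_card; apply: eq_leq; apply: eq_bigl => p; rewrite andbC.
apply: (@leq_trans (\sum_(v : vert B n.+1) N)); first by apply: leq_sum => v _; exact: NP.
by rewrite sum_nat_const leq_mul2r (MP n.+1).1 orbT.
Qed.

Lemma card_unsettled_semigroup f : bounded_type T -> label_semigroup a f ->
  exists C, forall n, #|unsettled_set f n| <= C.
Proof.
move=> /card_boundary[C CP]; elim=> [|_ [F _ <-]|{}f g Gf [Cf fC] _ [Cg gC]].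
- exists 0 => n; rewrite leqn0 cards_eq0; apply/eqP/setP => p; rewrite [RHS]inE.
  by apply/negbTE/unsettled_setP; right; exists p => x xp; exists x.
- exists C => n; apply: leq_trans (CP n); apply: subset_leq_card.
  apply/fintype.subsetP => p; apply: contraLR; rewrite inE => nb.
  by apply/unsettled_setP; exact: act_settled.
- exists (Cf + Cg) => n; apply: leq_trans (leq_add (fC n) (gC n)).
  apply: card_unsettled_comp => x x' y fx fx'.
  have [h _ hP] := label_semigroup_inv Gf.
  by move/hP: fx; move/hP: fx' => -> [].
Qed.

End LabelAction.

(** * Counting components *)

Section Components.
Variables (B : bratteli) (T : tile_inflation B) (a : label_action T).
Variables (L : finType) (linv : L -> L) (s : L -> Omega B -> Omega B).
Hypothesis sK : forall F, cancel (s F) (s (linv F)).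
Variable G : set (Omega B -> Omega B).
Hypotheses (Ggroup : homeo_group G) (Gs : forall F, G (s F))
  (Gmin : forall H, homeo_group H -> (forall F, H (s F)) -> G `<=` H).
Variables psi psi' : Omega B -> Omega B.
Hypotheses (psiK : cancel psi psi') (psi'K : cancel psi' psi)
  (psi_orbit : orbit_map (label_semigroup a) (pmaps_of G) psi).

Let settled_comp n (p : bpath B n) : bool :=
  [forall q, connect (@moves_adj B L s n) p q ==> ~~ unsettled s q].

Let comp_orbit n (x : Omega B) : set (Omega B) :=
  [set z | connect (@moves_adj B L s n) (trunc x n) (trunc z n) /\ same_tail n z x].

Lemma comp_orbit_finite n x : finite_set (comp_orbit n x).
Proof.
have /choice[z zP] (q : bpath B n) : exists z, forall z', trunc z' n = q -> same_tail n z' x -> z' = z.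
  have [[z [zq zx]]|h] := pselect (exists z, trunc z n = q /\ same_tail n z x).
    exists z => z' zq' zx'; apply: (@eq_trunc_tail _ n); first by rewrite zq zq'.
    by apply: (same_tail_trans zx'); exact: same_tail_sym.
  by exists x => z zq zx; case: h; exists z.
apply: sub_finite_set (finite_image z (@finite_finset _ [set: bpath B n])).
by move=> z' [_ zx] /=; exists (trunc z' n) => //; apply/esym/zP.
Qed.

(** Generators move settled paths inside their component and keep the tail. The equivalence, rather
    than one implication, lets the homeomorphisms with this property form a group. *)
Lemma comp_orbit_stable n x f : settled_comp (trunc x n) -> G f ->
  forall z, comp_orbit n x z <-> comp_orbit n x (f z).
Proof.
move=> xS Gf; have sO F z : comp_orbit n x z -> comp_orbit n x (s F z).
  move=> [c t]; have := forallP xS (trunc z n); rewrite c /= => /existsPn/(_ F)/negPn/existsP[q m].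
  have [e t'] := movesP _ _ _ _ m z erefl.
  split; last exact: same_tail_trans t.
  by apply: (connect_trans c); rewrite e; apply: connect1; apply/existsP; exists F.
suff [_] : (@homeo (Omega B) `&` [set f | forall z, comp_orbit n x z <-> comp_orbit n x (f z)]) f by [].
apply: (fun h1 h2 => Gmin h1 h2 Gf); last first.
  move=> F; split; first by case: Ggroup => + _ _ _; apply.
  by move=> z; split; [exact: sO|move=> /(sO (linv F)); rewrite sK].
split.
- by move=> g [].
- split=> //; case: Ggroup => + + _ _; exact.
- move=> g h [[g' [gc g'c gK g'K]] gO] [[h' [hc h'c hK h'K]] hO]; split.
    exists (g' \o h'); split.
    + by move=> z; apply: continuous_comp; [exact: gc|exact: hc].
    + by move=> z; apply: continuous_comp; [exact: h'c|exact: g'c].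
    + by move=> z /=; rewrite hK gK.
    + by move=> z /=; rewrite g'K h'K.
  by move=> z; rewrite gO hO.
- move=> g h [_ gO] [gc hc gK hK]; split; first by exists g.
  by move=> z; have := gO (h z); rewrite hK => e; split=> /e.
Qed.

(** The point [z] lies in the orbit of [psi' x] under the labels, so [psi z] lies in the [G]-orbit
    of [psi (psi' x) = x], which stays inside [comp_orbit n x]. *)
Lemma psi_tail n x m z : settled_comp (trunc x n) -> same_tail m z (psi' x) ->
  comp_orbit n x (psi z).
Proof.
move=> xS /(same_tail_orbit a)[g Gg gz].
have [_ [f Gf <-]] := psi_orbit Gg gz; rewrite psi'K => -[<-].
have [+ _] := comp_orbit_stable xS Gf x; apply; split; first exact: connect0.
exact: same_tail_refl.
Qed.

(** Pick a point [x i] over each settled component. The tail class of [psi' (x i)] is finite, as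
    [psi] maps it into a finite set, and two components sharing a class would coincide by
    [psi_tail]. *)
Lemma card_settled_comp M n : (forall m, #|vert B m| <= M) ->
  #|[set p : bpath B n | (comp_root s p == p) && settled_comp p]%SET| <= M.
Proof.
move=> BM.
pose I : finType := {p : bpath B n | (comp_root s p == p) && settled_comp p}.
have -> : #|[set p : bpath B n | (comp_root s p == p) && settled_comp p]%SET| = #|I|.
  by rewrite card_sig cardsE.
have /choice[x xP] (i : I) : exists x, trunc x n = val i by exact: trunc_surj.
have xS i : settled_comp (trunc (x i) n) by rewrite xP; case/andP: (valP i).
apply: (@card_tail_classes B I (psi' \o x)) => //.
- move=> i; apply: (sub_finite_set _ (finite_image psi' (comp_orbit_finite n (x i)))).
  move=> z [m zx]; exists (psi z); last exact: psiK.
  exact: psi_tail (xS i) zx.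
- move=> i j m /(psi_tail (xS j)); rewrite psi'K => -[+ _].
  rewrite !xP => /(comp_rootP sK) e; apply: val_inj.
  have /andP[/eqP <- _] := valP i; have /andP[/eqP <- _] := valP j.
  exact/esym.
Qed.

Lemma card_class N M n : (forall m, #|vert B m| <= M) ->
  #|[set p : bpath B n | unsettled s p]%SET| <= N ->
  #|class (@comp_root B L s) n| <= M + N.
Proof.
move=> BM UN; rewrite card_sig -cardsE.
set R := [set p | _]%SET; pose S := [set p : bpath B n | settled_comp p]%SET.
rewrite -(cardsID S R); apply: leq_add.
  by apply: leq_trans (card_settled_comp n BM); apply: eq_leq; apply: eq_card => p; rewrite !inE.
apply: leq_trans UN.
(* The remaining components are counted by an unsettled path chosen in each; different components
   yield different paths. *)
have /choice[t tP] (p : bpath B n) : exists q, ~~ settled_comp p ->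
    connect (@moves_adj B L s n) p q && unsettled s q.
  case: (boolP (settled_comp p)) => [_|/forallPn[q]]; first by exists p.
  by rewrite negb_imply negbK; exists q.
rewrite -(@card_in_imset _ _ t (R :\: S)).
  apply/subset_leq_card/fintype.subsetP => _ /imsetP[p + ->].
  by rewrite !inE => /andP[/tP/andP[_ u] _].
move=> p q; rewrite !inE => /andP[/tP/andP[+ _] /eqP pR] /andP[/tP/andP[+ _] /eqP qR].
by move=> /(comp_rootP sK) h /(comp_rootP sK) h' e; rewrite -pR -qR h h' e.
Qed.

End Components.

(** * From a finite generating set to the theorem *)

Lemma finite_set_enum (X : Type) (A : set X) : finite_set A ->
  exists n (f : 'I_n -> X), A = range f.
Proof.
elim/Pchoice: X => X in A *; move=> /finite_seqP[l ->].
exists (size l), (tnth (in_tuple l)); apply/seteqP; split=> x /=.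
  by move=> /(tnthP (in_tuple l) x)[i ->]; exists i.
by move=> [i _ <-]; exact: (mem_tnth i (in_tuple l)).
Qed.

Theorem corollary4p3 (B : bratteli) (T : tile_inflation B) (a : label_action T)
    (G : set (Omega B -> Omega B)) :
  bounded_type T ->
  homeo_group G ->
  G `<=` full_group (label_semigroup a) ->
  finitely_generated G ->
  orbit_equivalent (pmaps_of G) (label_semigroup a) ->
  bounded_type_group G.
Proof.
move=> bT Ggroup Gfull [A [/finite_set_enum[n [g ->]] AG Gmin]].
move=> [_ [psi [_ [psi' [_ _ psiK psi'K]] _ psiO]]].
have [Gh G1 GM GV] := Ggroup.
have Gg i : G (g i) by apply: AG; exists i.
have /choice[g' gP] i : exists f, homeo_pair (g i) f by exact/Gh/Gg.
have Gg' i : G (g' i) by apply: GV (gP i); exact: Gg.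
(* The flag marks formal inverses, so a label differs from its inverse even when the generator is an
   involution. *)
pose s (F : 'I_n * bool) := if F.2 then g' F.1 else g F.1.
pose linv (F : 'I_n * bool) := (F.1, ~~ F.2).
have linvK : involutive linv by case=> i b; rewrite /linv /= negbK.
have linv_neq F : linv F != F by case: F => i b; rewrite xpair_eqE /= eqxx; case: b.
have sK F : cancel (s F) (s (linv F)) by case: F => i []; case: (gP i).
have s_cont F : continuous (s F) by case: F => i []; case: (gP i).
have Gs F : G (s F) by case: F => i []; [exact: Gg'|exact: Gg].
have Gmin' H : homeo_group H -> (forall F, H (s F)) -> G `<=` H.
  by move=> Hg Hs; apply: Gmin => // _ [i _ <-]; exact: (Hs (i, false)).
have [_ _ [M MP]] := bT.
have [N NP] : exists N, forall m, #|[set p : bpath B m | unsettled s p]%SET| <= N.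
  have /choice[C CP] F : exists C, forall m, #|unsettled_set (fun x => Some (s F x)) m| <= C.
    by apply: card_unsettled_full (Gfull _ (Gs F)) => f; exact: card_unsettled_semigroup.
  (* A path unsettled for the generating family is unsettled for one of the generators, all of which
     lie in the full group. *)
  exists (\sum_F C F) => m.
  apply: (@leq_trans #|(\bigcup_F unsettled_set (fun x => Some (s F x)) m)%SET|).
    apply: subset_leq_card; apply/fintype.subsetP => p; rewrite inE => /existsP[F h].
    apply/finset.bigcupP; exists F => //; apply: contraNT h => /unsettled_setP[h|[q qP]].
      by have [x /h] := trunc_surj p.
    by apply/existsP; exists q; apply/movesP => x /qP[_ [[<-]]].
  apply: (@leq_trans (\sum_F #|unsettled_set (fun x => Some (s F x)) m|)).
    exact: card_bigcup_le.
  by apply: leq_sum => F _; exact: CP.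
have BM m : #|vert B m| <= M by case: (MP m).
apply: (@generated_bounded_type_group _ _ linv s linvK linv_neq sK s_cont G Ggroup Gs Gmin' N (M + N)) => //.
  by move=> m; have [h h'] := MP m; split; apply: leq_trans (leq_addr _ _).
by move=> m; exact: (card_class sK Ggroup Gs Gmin' psiK psi'K psiO BM (NP m)).
Qed.
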